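(* Let $A$ be a continuous dcpo and let $\mu$ be a CC-valuation on its Scott open sets, extended to the unique finitely additive measure (also denoted $\mu$) on the ring of subsets of $A$ generated by the Scott open sets. For $x\in A$ let $C_x=\{y\mid y\sqsubseteq x\}$, $I_x=\{y\in A\mid\{x,y\}\text{ has no upper bound in }A\}$, $J_x=\{y\in A\mid x\in\mathrm{Int}(I_y)\}$, $J'_x=\mathrm{Int}(J_x)$; write $x\not\sim y$ iff $x\in J'_y$; and let $l(x,y)=\mu(C_x\cap J'_y)+\mu(C_y\cap J'_x)$. Then for all $x,y\in A$, $x\not\sim y$ if and only if $l(x,y)\ne0$.
   Context: Directed sets are nonempty. A dcpo is a poset with least element in which every directed subset has a least upper bound. $x\ll y$ means: for every directed $S$ with $y\sqsubseteq\sqcup S$ there is $s\in S$ with $x\sqsubseteq s$. A dcpo $A$ is continuous (with basis $K\subseteq A$) if for every $a\in A$ the set $\{k\in K\mid k\ll a\}$ is directed with supremum $a$. $U\subseteq A$ is Scott open if it is upward closed and meets every directed $S$ with $\sqcup S\in U$; $\mathrm{Int}$ is interior in the Scott topology. A CC-valuation is a function $\mu$ from Scott open sets to $[0,1]$ with $\mu(\emptyset)=0$, $\mu(A)=1$, $U\subseteq V\Rightarrow\mu(U)\le\mu(V)$, $\mu(U)+\mu(V)=\mu(U\cap V)+\mu(U\cup V)$, which is continuous ($\mu(\bigcup_iU_i)=\sup_i\mu(U_i)$ for directed systems of open sets), strongly non-degenerate ($U\subsetneq V\Rightarrow\mu(U)<\mu(V)$) and co-continuous ($\mu(\mathrm{Int}(\bigcap_iU_i))=\inf_i\mu(U_i)$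 for filtered, i.e. nonempty downward directed, systems of open sets). The extension satisfies $\mu(U\cap C)=\mu(U)-\mu(U\setminus C)$ for $U$ open and $C$ closed. *)

(* Defs.v *)
From HB Require Import structures.
From mathcomp Require Import all_boot all_order all_algebra.
From mathcomp Require Import all_classical all_reals all_analysis.

Set Implicit Arguments.
Unset Strict Implicit.
Unset Printing Implicit Defensive.

Import Order.TTheory GRing.Theory Num.Theory.

Local Open Scope classical_set_scope.
Local Open Scope ring_scope.

(* The relation is a parameter so that the same notion serves for subsets of a
   poset (<=), directed families of sets (subset) and filtered families of sets
   (converse of subset). *)
Definition directed (T : Type) (le : T -> T -> Prop) (S : set T) : Prop :=
  S !=set0 /\
  forall x y, S x -> S y -> exists z, [/\ S z, le x z & le y z].

Section domain.
Context {d : Order.disp_t}.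
Implicit Type A : bPOrderType d.

Definition odirected A (S : set A) : Prop := directed (fun x y => (x <= y)%O) S.

(* The least element is part of the structure bPOrderType. *)
Definition dcpo A : Prop :=
  forall S : set A, odirected S -> exists s, isLub S s.

Definition way_below A (x y : A) : Prop :=
  forall (S : set A) (s : A), odirected S -> isLub S s -> (y <= s)%O ->
    exists2 z, S z & (x <= z)%O.

Definition domain_basis A (K : set A) : Prop :=
  forall a : A, let Ka := [set k | K k /\ way_below k a] in
    odirected Ka /\ isLub Ka a.

Definition continuous_dcpo A : Prop :=
  dcpo A /\ exists K : set A, domain_basis K.

Definition scott_open A (U : set A) : Prop :=
  (forall x y, (x <= y)%O -> U x -> U y) /\
  (forall (S : set A) (s : A), odirected S -> isLub S s -> U s ->
     U `&` S !=set0).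

Lemma scott_openT A : scott_open [set: A].
Proof. by split=> // S s [[x Sx] _] _ _; exists x. Qed.

Lemma scott_openI A : setI_closed (@scott_open A).
Proof.
move=> U V [upU scU] [upV scV]; split.
  by move=> x y xy [Ux Vx]; split; [exact: upU Ux|exact: upV Vx].
move=> S s dS ls [Us Vs].
have [x [Ux Sx]] := scU _ _ dS ls Us; have [y [Vy Sy]] := scV _ _ dS ls Vs.
have [z [Sz xz yz]] := dS.2 _ _ Sx Sy.
by exists z; split => //; split; [exact: upU Ux|exact: upV Vy].
Qed.

Lemma scott_open_bigU A (I : Type) (f : I -> set A) :
  (forall i, scott_open (f i)) -> scott_open (\bigcup_i f i).
Proof.
move=> fo; split.
  by move=> x y xy [i _ fx]; exists i => //; exact: (fo i).1 xy fx.
move=> S s dS ls [i _ fs]; have [z [fz Sz]] := (fo i).2 _ _ dS ls fs.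
by exists z; split => //; exists i.
Qed.

End domain.

(* A with its Scott topology and with the ring of sets generated by it. *)
Definition scott {d : Order.disp_t} (A : bPOrderType d) : Type := A.

Definition scott_ring_display : measure_display.
Proof. exact: default_measure_display. Qed.

Section scott_instances.
Context {d : Order.disp_t} (A : bPOrderType d).

HB.instance Definition _ := Order.BPOrder.on (scott A).
HB.instance Definition _ := isPointed.Build (scott A) \bot%O.
HB.instance Definition _ := isOpenTopological.Build (scott A)
  (@scott_openT d A) (@scott_openI d A) (@scott_open_bigU d A).
HB.instance Definition _ := isRingOfSets.Build scott_ring_display (scott A)
  (@setring0 _ (@open (scott A))) (@setringU _ (@open (scott A)))
  (@setringD _ (@open (scott A))).

Lemma scott_openE : @open (scott A) = @scott_open d A.
Proof. by []. Qed.

Lemma scott_measurableE :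
  @measurable scott_ring_display (scott A) = <<r @open (scott A) >>.
Proof. by []. Qed.

End scott_instances.

(* Only the values of nu on Scott open sets are constrained. *)
Record cc_valuation {d : Order.disp_t} (A : bPOrderType d) (R : realType)
    (nu : set (scott A) -> R) : Prop := CCValuation {
  cc_range : forall U, open U -> 0 <= nu U <= 1 ;
  cc_set0 : nu set0 = 0 ;
  cc_setT : nu setT = 1 ;
  cc_mono : forall U V, open U -> open V -> U `<=` V -> nu U <= nu V ;
  cc_modular : forall U V, open U -> open V ->
    nu U + nu V = nu (U `&` V) + nu (U `|` V) ;
  cc_continuous : forall F : set (set (scott A)), F `<=` open ->
    directed (fun U V => U `<=` V) F ->
    nu (\bigcup_(U in F) U) = sup (nu @` F) ;
  cc_nondegenerate : forall U V, open U -> open V -> U `<` V ->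
    nu U < nu V ;
  cc_cocontinuous : forall F : set (set (scott A)), F `<=` open ->
    directed (fun U V => V `<=` U) F ->
    nu (\bigcap_(U in F) U)° = inf (nu @` F) }.

Section apartness.
Context {d : Order.disp_t} {A : bPOrderType d}.
Implicit Types x y : scott A.

(* C_x, I_x, J_x, J'_x, the relation x in J'_y, and l(x, y).  A content on
   scott A is a finitely additive measure on the ring generated by the open
   sets, which is where the closed sets C_x live. *)
Definition lower_set x : set (scott A) := [set y | (y <= x)%O].

Definition inconsistent x : set (scott A) :=
  [set y | ~ has_ubound [set x; y]].

Definition apart_pts x : set (scott A) := [set y | (inconsistent y)° x].

Definition apart_int x : set (scott A) := (apart_pts x)°.

Definition apart x y : Prop := apart_int y x.

Definition apart_measure (R : realType)
    (mu : {content set (scott A) -> \bar R}) x y : \bar R :=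
  (mu (lower_set x `&` apart_int y) + mu (lower_set y `&` apart_int x))%E.

End apartness.

(* Main.v *)
Require Import Defs.
From mathcomp Require Import all_boot all_order all_algebra.
From mathcomp Require Import all_classical all_reals all_analysis.

(** In a continuous dcpo, x and y are apart iff some h << x and k << y have no
    common upper bound; hence apartness is symmetric.  If l(x, y) <> 0, then
    C_x meets J'_y or C_y meets J'_x, so x and y are apart since J'_x and J'_y
    are upper sets.  If x is in J'_y, then J'_y \ C_x is an open proper subset
    of J'_y, so strong non-degeneracy makes the measure of their difference,
    which is C_x `&` J'_y, positive. *)

Import Order.TTheory GRing.Theory Num.Theory.

Local Open Scope classical_set_scope.
Local Open Scope ring_scope.

Section way_below.
Set Implicit Arguments.
Unset Strict Implicit.
Context {d : Order.disp_t} {A : bPOrderType d}.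
Implicit Types a b x y : A.

Lemma way_below_le_trans x y b : way_below x y -> (y <= b)%O -> way_below x b.
Proof. by move=> xy yb S s dS ls bs; exact: xy dS ls (le_trans yb bs). Qed.

Lemma le_way_below_trans a x y : (a <= x)%O -> way_below x y -> way_below a y.
Proof.
move=> ax xy S s dS ls ys; have [z Sz xz] := xy _ _ dS ls ys.
by exists z => //; exact: le_trans ax xz.
Qed.

Lemma way_below_le x y : way_below x y -> (x <= y)%O.
Proof.
(* Test [way_below x y] on the singleton of [y], a directed set with supremum [y]. *)
move=> /(_ [set y] y) [] //; last by move=> z ->.
  by split; [exists y|move=> _ _ -> ->; exists y].
by split=> [z ->//|z]; apply.
Qed.

(** The basis elements [m] that are way below some basis element [k] way below [y] form a directed
    set with supremum [y]. Hence [x] lies below such an [m], and its [k] interpolates. *)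
Lemma way_below_interpolation (K : set A) x y : domain_basis K ->
  way_below x y -> exists2 z, way_below x z & way_below z y.
Proof.
move=> basisK xy.
pose D := [set m | exists k, [/\ K k, way_below k y, K m & way_below m k]].
have dD : odirected D.
  split.
    have [[[k [Kk ky]] _] _] := basisK y.
    have [[[m [Km mk]] _] _] := basisK k.
    by exists m, k.
  move=> m1 m2 [k1 [Kk1 k1y Km1 m1k1]] [k2 [Kk2 k2y Km2 m2k2]].
  have [[_ dirKy] _] := basisK y.
  have [k [[Kk ky] k1k k2k]] := dirKy k1 k2 (conj Kk1 k1y) (conj Kk2 k2y).
  have [[_ dirKk] _] := basisK k.
  have [m [[Km mk] m1m m2m]] := dirKk m1 m2
    (conj Km1 (way_below_le_trans m1k1 k1k))
    (conj Km2 (way_below_le_trans m2k2 k2k)).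
  by exists m; split=> //; exists k.
have lubD : isLub D y.
  split=> [m [k [_ ky _ mk]]|u ubu].
    exact: le_trans (way_below_le mk) (way_below_le ky).
  have [_ [_ leasty]] := basisK y; apply: leasty => k [Kk ky].
  have [_ [_ leastk]] := basisK k; apply: leastk => m [Km mk].
  by apply: ubu; exists k.
have [m [k [_ ky _ mk]] xm] := xy _ _ dD lubD (lexx y).
by exists k => //; exact: le_way_below_trans xm mk.
Qed.

Lemma open_way_below (K : set A) x : domain_basis K ->
  open ([set y | way_below x y] : set (scott A)).
Proof.
move=> basisK; rewrite scott_openE; split=> [y z yz xy|S s dS ls xs].
  exact: way_below_le_trans xy yz.
have [k xk ks] := way_below_interpolation basisK xs.
have [z Sz kz] := ks _ _ dS ls (lexx s).
by exists z; split=> //; exact: way_below_le_trans xk kz.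
Qed.

(** The basis elements way below [y] are directed with supremum [y], so the open set [X°] contains
    one of them. *)
Lemma scott_interior_way_below (K : set A) (X : set (scott A)) y :
  domain_basis K -> X° y -> exists2 k, way_below k y & X k.
Proof.
move=> basisK Xy; have [dirKy lubKy] := basisK y.
have [_ /(_ _ _ dirKy lubKy Xy) [k [Xk [_ ky]]]] := open_interior X.
by exists k => //; exact: interior_subset Xk.
Qed.

Lemma closed_lower_set x : closed (lower_set (x : scott A)).
Proof.
rewrite -openC scott_openE; split=> [y z yz nyx zx|S s dS [ubs leasts] nsx].
  by apply: nyx; exact: le_trans yz zx.
(* If [S] missed the complement of [lower_set x], then [x] would bound [S] and hence its
   supremum. *)
apply: contrapT => noS; apply: nsx; apply: leasts => z Sz.
by apply: contrapT => nzx; apply: noS; exists z.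
Qed.

Lemma scott_open_upper (U : set (scott A)) x y :
  open U -> (x <= y)%O -> U x -> U y.
Proof. by case=> + _; exact. Qed.

End way_below.

Section apartness.
Set Implicit Arguments.
Unset Strict Implicit.
Context {d : Order.disp_t} {A : bPOrderType d}.
Implicit Types x y : scott A.

(** This unfolds the two nested interiors into a condition symmetric in [x] and [y]. Conversely, the
    points way above [h] and those way above [k] form open sets, and a common bound of a point from
    each would bound [h] and [k]. *)
Lemma apart_way_belowP (K : set A) (basisK : domain_basis K) x y :
  apart x y <->
  exists h k : A, [/\ way_below h x, way_below k y & inconsistent h k].
Proof.
split.
  move=> /(scott_interior_way_below basisK) [h hx].
  by move=> /(scott_interior_way_below basisK) [k ky hk]; exists h, k.
move=> [h [k [hx ky hk]]].
suff : [set z | way_below h z] `<=` apart_pts y.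
  by rewrite (open_subsetE _ (open_way_below h basisK)); apply.
move=> z hz.
suff : [set w | way_below k w] `<=` inconsistent z.
  by rewrite (open_subsetE _ (open_way_below k basisK)); apply.
move=> w kw [u ubu]; apply: hk; exists u => _ [->|->].
  by apply: le_trans (way_below_le hz) _; apply: ubu; left.
by apply: le_trans (way_below_le kw) _; apply: ubu; right.
Qed.

Lemma inconsistent_sym x y : inconsistent x y -> inconsistent y x.
Proof. by rewrite /inconsistent /= setUC. Qed.

Lemma apart_sym x y : continuous_dcpo A -> apart x y -> apart y x.
Proof.
move=> [_ [K basisK]] /(apart_way_belowP basisK) [h [k [hx ky hk]]].
apply/(apart_way_belowP basisK); exists k, h; split=> //.
exact: inconsistent_sym.
Qed.

Lemma lower_set_apart_int x y : lower_set x `&` apart_int y !=set0 -> apart x y.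
Proof.
by case=> z [zx]; apply: scott_open_upper zx; exact: open_interior.
Qed.

Lemma content_lower_setI_gt0 {R : realType} {nu : set (scott A) -> R}
    {mu : {content set (scott A) -> \bar R}} (U : set (scott A)) x :
  cc_valuation nu -> (forall V, open V -> mu V = (nu V)%:E) ->
  open U -> U x -> (0 < mu (lower_set x `&` U))%E.
Proof.
move=> ccnu mu_nu oU Ux.
have oUC : open (U `\` lower_set x).
  by rewrite setDE; apply: openI => //; apply/closed_openC/closed_lower_set.
have measurable_open V : open V -> measurable (V : set (scott A)).
  by move=> oV; exact: sub_gen_smallest.
(* The intersection is the difference of the open sets [U] and [U] minus [lower_set x], so it lies
   in the ring. *)
have mI : measurable (lower_set x `&` U).
  by rewrite setIC -setDD; apply: measurableD; exact: measurable_open.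
have : (mu (U `\` lower_set x) < mu U)%E.
  rewrite !mu_nu// lte_fin; apply: cc_nondegenerate ccnu _ _ oUC oU _.
  by split=> [|/(_ x Ux) [_]]; [exact: subDsetl|apply; exact: lexx].
(* Split [U] into its parts outside and inside [lower_set x]; the outer part is open, so its measure
   is finite and cancels. *)
rewrite -[X in (_ < mu X)%E](setDUK (@subDsetl _ U (lower_set x))).
rewrite setDD setIC measureU//; last first.
- by rewrite setIA setDKI set0I.
- exact: measurable_open.
by rewrite mu_nu// lteDl.
Qed.

End apartness.

Theorem theorem12p7p1 (d : Order.disp_t) (A : bPOrderType d) (R : realType)
    (nu : set (scott A) -> R) (mu : {content set (scott A) -> \bar R}) :
  continuous_dcpo A ->
  cc_valuation nu ->
  (forall U : set (scott A), open U -> mu U = (nu U)%:E) ->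
  forall x y : scott A, apart x y <-> apart_measure mu x y <> 0%E.
Proof.
move=> contA ccnu mu_nu x y; split=> [xy|].
  apply/eqP; rewrite gt_eqF// /apart_measure.
  (* The first summand alone is positive. *)
  apply: lt_le_trans (leeDl _ (measure_ge0 mu _)).
  exact: content_lower_setI_gt0 ccnu mu_nu (@open_interior _ _) xy.
apply: contra_notP => nxy; rewrite /apart_measure.
(* Symmetry is needed to make the second summand vanish too. *)
have nyx : ~ apart y x by move/(apart_sym contA).
have eq0 u v : ~ apart u v -> lower_set u `&` apart_int v = set0.
  by move=> nuv; apply: contra_notP nuv => /eqP/set0P/lower_set_apart_int.
by rewrite !eq0// measure0 adde0.
Qed.
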